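(* Let $f(x) = \dfrac{1}{(1-x)(1-x^{2})}$, let $a(n) = [x^{n}]\, f(x)^{n}$ for $n \ge 0$, and let $A(t) = \sum_{n\ge 0} a(n)\,t^{n}$. Let $y = y(t)$ be the unique formal power series with zero constant term satisfying $y = t\, f(y)$, i.e. $y(1-y)^{2}(1+y) = t$. Then $$A(t) \;=\; \frac{1 - y^{2}}{1 - y - 4 y^{2}}$$ as formal power series in $t$.
   Context: All series are formal power series with rational coefficients. $[x^{n}]\,g(x)$ denotes the coefficient of $x^{n}$ in the formal power series $g(x)$. The function $f(x)=1/((1-x)(1-x^2))$ is viewed as a formal power series in $x$, so $f(0)=1$. In the conclusion, $y$ stands for the series $y(t)$. *)

(* Defs.v *)
From HB Require Import structures.
From mathcomp Require Import all_boot all_order all_algebra.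
From mathcomp Require Import boolp.

Set Implicit Arguments.
Unset Strict Implicit.
Unset Printing Implicit Defensive.

Import GRing.Theory.
Local Open Scope ring_scope.

(* A record rather than an alias of [nat -> R], on which the inferred ring
   structure would be the pointwise one. *)
Record fps (R : Type) := FPS { fps_coef : nat -> R }.

Notation "[x^ n ] g" := (fps_coef g n)
  (at level 9, n at level 200, g at level 9, format "[x^  n ]  g").

HB.instance Definition _ (R : Type) := gen_eqMixin (fps R).
HB.instance Definition _ (R : Type) := gen_choiceMixin (fps R).

Lemma fpsP (R : Type) (a b : fps R) : (forall n, [x^ n] a = [x^ n] b) <-> a = b.
Proof.
split=> [|-> //]; case: a b => [a] [b] /= eq_ab.
by congr FPS; apply: funext.
Qed.

Section Zmodule.
Variable R : zmodType.
Implicit Types a b c : fps R.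

Definition fps_zero : fps R := FPS (fun=> 0).
Definition fps_opp a : fps R := FPS (fun n => - [x^ n] a).
Definition fps_add a b : fps R := FPS (fun n => [x^ n] a + [x^ n] b).

Fact fps_addA : associative fps_add.
Proof. by move=> a b c; apply/fpsP=> n /=; rewrite addrA. Qed.
Fact fps_addC : commutative fps_add.
Proof. by move=> a b; apply/fpsP=> n /=; rewrite addrC. Qed.
Fact fps_add0 : left_id fps_zero fps_add.
Proof. by move=> a; apply/fpsP=> n /=; rewrite add0r. Qed.
Fact fps_addN : left_inverse fps_zero fps_opp fps_add.
Proof. by move=> a; apply/fpsP=> n /=; rewrite addNr. Qed.

HB.instance Definition _ :=
  GRing.isZmodule.Build (fps R) fps_addA fps_addC fps_add0 fps_addN.

End Zmodule.

Section ComRing.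
Variable R : comNzRingType.
Implicit Types a b c : fps R.

Definition fps_const (c : R) : fps R := FPS (fun n => if n == 0%N then c else 0).
Definition fpsX : fps R := FPS (fun n => (n == 1%N)%:R).
Definition fps_mul a b : fps R :=
  FPS (fun n => \sum_(k < n.+1) [x^ k] a * [x^ (n - k)] b).

Definition fps_trunc (N : nat) a : {poly R} := \poly_(i < N) [x^ i] a.

Lemma coef_fps_trunc N a i : (i < N)%N -> (fps_trunc N a)`_i = [x^ i] a.
Proof. by move=> iN; rewrite coef_poly iN. Qed.

Lemma coef_fps_mul N a b i : (i < N)%N ->
  [x^ i] (fps_mul a b) = (fps_trunc N a * fps_trunc N b)`_i.
Proof.
move=> iN; rewrite coefM /=; apply: eq_bigr => j _.
by rewrite !coef_fps_trunc // (leq_ltn_trans _ iN) ?leq_subr // -ltnS.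
Qed.

Fact fps_mulC : commutative fps_mul.
Proof.
by move=> a b; apply/fpsP=> n; rewrite !(@coef_fps_mul n.+1) // mulrC.
Qed.

Fact fps_mulA : associative fps_mul.
Proof.
move=> a b c; apply/fpsP=> n.
have le_sub j : (n - j < n.+1)%N by rewrite ltnS leq_subr.
transitivity (fps_trunc n.+1 a * (fps_trunc n.+1 b * fps_trunc n.+1 c))`_n.
  rewrite [RHS]coefM /=; apply: eq_bigr => j _.
  by rewrite coef_fps_trunc // -(@coef_fps_mul n.+1).
rewrite mulrA [LHS]coefM /=; apply: eq_bigr => j _.
by rewrite -(@coef_fps_mul n.+1) // coef_fps_trunc.
Qed.

Fact fps_mul1 : left_id (fps_const 1) fps_mul.
Proof.
move=> a; apply/fpsP=> n /=; rewrite big_ord_recl /= mul1r subn0 big1 ?addr0 //.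
by move=> i _; rewrite mul0r.
Qed.

Fact fps_mulDl : left_distributive fps_mul (@fps_add R).
Proof.
move=> a b c; apply/fpsP=> n /=; rewrite -big_split.
by apply: eq_bigr => i _; rewrite mulrDl.
Qed.

Fact fps_one_neq0 : fps_const 1 != fps_zero R.
Proof. by apply/eqP => /fpsP/(_ 0%N) /= /eqP; rewrite oner_eq0. Qed.

HB.instance Definition _ := GRing.Zmodule_isComNzRing.Build (fps R)
  fps_mulA fps_mulC fps_mul1 fps_mulDl fps_one_neq0.

(* The composite f(g), meaningful when g has zero constant term: then g ^+ k
   contributes to the coefficient of x^n only for k <= n (fps_coefX_eq0). *)
Definition fps_comp (f g : fps R) : fps R :=
  FPS (fun n => \sum_(k < n.+1) [x^ k] f * [x^ n] (g ^+ k)).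

Lemma fps_coefX_eq0 (g : fps R) k n :
  [x^ 0] g = 0 -> (n < k)%N -> [x^ n] (g ^+ k) = 0.
Proof.
move=> g0; elim: k n => // k IHk n ltnk; rewrite exprS.
rewrite [LHS]big_ord_recl /= g0 mul0r add0r big1 // => i _.
rewrite IHk ?mulr0 //= /bump add1n.
case: n i ltnk => [[]|n i] //; rewrite subSS ltnS.
by apply: leq_trans; rewrite ltnS leq_subr.
Qed.

Lemma fps_geomP (u : fps R) : [x^ 0] u = 0 ->
  fps_comp (FPS (fun=> 1)) u * (1 - u) = 1.
Proof.
move=> u0; apply/fpsP=> n.
have gE i : (i <= n)%N ->
    [x^ i] (fps_comp (FPS (fun=> 1)) u) = [x^ i] (\sum_(k < n.+1) u ^+ k).
  have coef_sum m : [x^ i] (\sum_(k < m) u ^+ k) = \sum_(k < m) [x^ i] (u ^+ k).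
    by elim: m => [|m IHm]; rewrite ?big_ord0 // !big_ord_recr /= -IHm.
  move=> le_in; rewrite coef_sum /=.
  rewrite (big_ord_widen n.+1 (fun k => 1 * [x^ i] (u ^+ k))) //.
  rewrite big_mkcond; apply: eq_bigr => k _; rewrite mul1r ltnS.
  by case: leqP => // /(fps_coefX_eq0 u0).
transitivity ([x^ n] ((\sum_(k < n.+1) u ^+ k) * (1 - u))).
  by apply: eq_bigr => k _; rewrite gE // -ltnS.
rewrite mulrC -opprB mulNr -subrX1 opprB.
have -> : [x^ n] (1 - u ^+ n.+1) = [x^ n] (1 : fps R) - [x^ n] (u ^+ n.+1) by [].
by rewrite fps_coefX_eq0 // subr0.
Qed.

End ComRing.

Section UnitRing.
Variable R : comUnitRingType.
Implicit Types a b : fps R.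

Definition fps_unit : {pred fps R} := [pred a | [x^ 0] a \is a GRing.unit].

(* With c the constant term of a, a^-1 = c^-1 / (1 - u) for u = 1 - a / c. *)
Definition fps_inv a : fps R :=
  if a \in fps_unit then
    let d := fps_const ([x^ 0] a)^-1 in
    d * fps_comp (FPS (fun=> 1)) (1 - d * a)
  else a.

Lemma fps_coef0M a b : [x^ 0] (a * b) = [x^ 0] a * [x^ 0] b.
Proof. by rewrite [LHS]big_ord_recl big_ord0 addr0. Qed.

Fact fps_mulVr : {in fps_unit, left_inverse 1 fps_inv *%R}.
Proof.
move=> a Ua; rewrite /fps_inv Ua /=; set d := fps_const _.
have u0 : [x^ 0] (1 - d * a) = 0.
  have -> : [x^ 0] (1 - d * a) = 1 - [x^ 0] (d * a) by [].
  by rewrite fps_coef0M /= mulVr // subrr.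
by have := fps_geomP u0; rewrite opprB addrCA subrr addr0 mulrCA mulrA.
Qed.

Fact fps_unitPl a b : b * a = 1 -> fps_unit a.
Proof.
move=> ba1; rewrite /fps_unit /=; apply/unitrPr; exists ([x^ 0] b).
by rewrite mulrC -fps_coef0M ba1.
Qed.

Fact fps_invr_out : {in [predC fps_unit], fps_inv =1 id}.
Proof. by move=> a; rewrite inE /= /fps_inv => /negbTE ->. Qed.

HB.instance Definition _ := GRing.ComNzRing_hasMulInverse.Build (fps R)
  fps_mulVr fps_unitPl fps_invr_out.

End UnitRing.

Arguments fpsX {R}.

Definition f_series : fps rat := 1 / ((1 - fpsX) * (1 - fpsX ^+ 2)).

Fact f_series_coef0 : [x^ 0] f_series = 1.
Proof.
set d : fps rat := (1 - fpsX) * (1 - fpsX ^+ 2).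
have d0 : [x^ 0] d = 1.
  have coefB0 (a b : fps rat) : [x^ 0] (a - b) = [x^ 0] a - [x^ 0] b by [].
  by rewrite fps_coef0M !coefB0 expr2 fps_coef0M /= mulr0 !subr0 mulr1.
have Ud : d \is a GRing.unit.
  by change ([x^ 0] d \is a GRing.unit); rewrite d0 unitr1.
have : [x^ 0] (f_series * d) = 1 by rewrite divrK.
by rewrite fps_coef0M d0 mulr1.
Qed.

Definition a_coef (n : nat) : rat := [x^ n] (f_series ^+ n).

Definition A_series : fps rat := FPS a_coef.

(* Main.v *)
Require Import Defs.
From HB Require Import structures.
From mathcomp Require Import all_boot all_order all_algebra.
From mathcomp Require Import ring.

Set Implicit Arguments.
Unset Strict Implicit.
Unset Printing Implicit Defensive.

Import GRing.Theory Num.Theory.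
Local Open Scope ring_scope.

(** Write g = (1 - x)(1 - x^2) for the inverse of f and phi = x g, so that the
    equation y = t f(y) says phi(y) = t: multiply by g(y), the inverse of f(y)
    ([f_series_compK]).  Existence and uniqueness of y hold because
    y |-> t F(y) is a contraction: if two series agree below degree n, their
    images agree below degree n + 1 ([fps_agree_comp], [fps_agreeXM]).

    The closed form of A is a case of Lagrange inversion, in the form
      [t^n] G = Res G(t) dt / t^(n+1) = Res G(phi(x)) phi'(x) dx / phi(x)^(n+1)
              = [x^n] G(phi) phi' f^(n+1)            ([fps_lagrange]).
    Take for G the right-hand side B = (1 - y^2) / (1 - y - 4 y^2).  Composing
    phi(y) = t with phi gives phi(y o phi) = phi, and P |-> phi(P) is injective
    on series without constant term ([quartic_inj]), so y o phi = x.  As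
    composition with phi is a ring morphism ([fps_comp_rmorphism]),
      B(phi) (1 - x - 4 x^2) = 1 - x^2.
    On the other hand phi' = (1 - x)(1 - x - 4 x^2) ([theta_denom]), whence
    B(phi) phi' = (1 - x)(1 - x^2) = g, and [t^n] B = [x^n] g f^(n+1)
    = [x^n] f^n = a(n). *)

(** * Coefficients of sums and products *)

Section Coefficients.
Variable R : comNzRingType.
Implicit Types a b u F G : fps R.

Lemma fps_coefD a b n : [x^ n] (a + b) = [x^ n] a + [x^ n] b.
Proof. by []. Qed.

Lemma fps_coefB a b n : [x^ n] (a - b) = [x^ n] a - [x^ n] b.
Proof. by []. Qed.

Lemma fps_coefM a b n :
  [x^ n] (a * b) = \sum_(k < n.+1) [x^ k] a * [x^ (n - k)] b.
Proof. by []. Qed.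

Lemma fps_coef_sum (I : Type) (r : seq I) (P : pred I) (a : I -> fps R) n :
  [x^ n] (\sum_(i <- r | P i) a i) = \sum_(i <- r | P i) [x^ n] (a i).
Proof. by elim/big_rec2: _ => [//|i c b _ <-]. Qed.

Lemma fps_coefCM c a n : [x^ n] (fps_const c * a) = c * [x^ n] a.
Proof.
rewrite fps_coefM big_ord_recl subn0 /= big1 ?addr0 // => i _.
by rewrite mul0r.
Qed.

Lemma fps_coefXM0 a : [x^ 0] (fpsX * a) = 0.
Proof. by rewrite fps_coefM big_ord_recl big_ord0 /= mul0r addr0. Qed.

Lemma fps_coefXMS a n : [x^ n.+1] (fpsX * a) = [x^ n] a.
Proof.
rewrite fps_coefM !big_ord_recl /= mul0r add0r mul1r subn1 /= big1 ?addr0 //.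
by move=> i _; rewrite mul0r.
Qed.

Lemma fps_coefXnM a k n : [x^ (k + n)] (fpsX ^+ k * a) = [x^ n] a.
Proof.
elim: k => [|k IHk]; first by rewrite expr0 mul1r.
by rewrite exprS -mulrA addSn fps_coefXMS.
Qed.

Fact fps_const_additive : zmod_morphism (@fps_const R).
Proof. by move=> c d; apply/fpsP=> -[|n] //=; rewrite subr0. Qed.

Fact fps_const_multiplicative : monoid_morphism (@fps_const R).
Proof.
by split=> // c d; apply/fpsP=> -[|n]; rewrite fps_coefCM //= mulr0.
Qed.

HB.instance Definition _ :=
  GRing.isZmodMorphism.Build R (fps R) (@fps_const R) fps_const_additive.
HB.instance Definition _ :=
  GRing.isMonoidMorphism.Build R (fps R) (@fps_const R) fps_const_multiplicative.

End Coefficients.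

(** * Agreement of power series up to a given degree *)

Section Agreement.
Variable R : comNzRingType.
Implicit Types a b u F G : fps R.

Definition fps_agree n a b := forall i, (i < n)%N -> [x^ i] a = [x^ i] b.

Lemma fps_agreeM n a a' b b' :
  fps_agree n a a' -> fps_agree n b b' -> fps_agree n (a * b) (a' * b').
Proof.
move=> eqa eqb i lt_in; rewrite !fps_coefM; apply: eq_bigr => k _.
rewrite eqa ?eqb //; first exact: leq_ltn_trans (leq_subr _ _) lt_in.
by apply: leq_ltn_trans lt_in; rewrite -ltnS.
Qed.

Lemma fps_agreeX n a b k : fps_agree n a b -> fps_agree n (a ^+ k) (b ^+ k).
Proof.
move=> eqab; elim: k => [|k IHk] //; rewrite !exprS; exact: fps_agreeM.
Qed.

(** The coefficient of x^n in F(a) is a finite expression in the coefficients of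
    [a] of degree at most n. *)
Lemma fps_agree_comp n F a b :
  fps_agree n a b -> fps_agree n (fps_comp F a) (fps_comp F b).
Proof.
move=> eqab i lt_in; apply: eq_bigr => k _.
by rewrite (@fps_agreeX n a b).
Qed.

Lemma fps_agreeXM n a b :
  fps_agree n a b -> fps_agree n.+1 (fpsX * a) (fpsX * b).
Proof.
by move=> eqab [|i] lt_in; rewrite ?fps_coefXM0 // !fps_coefXMS eqab.
Qed.

End Agreement.

(** * The equation y = x F(y) *)

Section FixedPoint.
Variables (R : comNzRingType) (F : fps R).

Let step (y : fps R) := fpsX * fps_comp F y.

Let step_agree n a b : fps_agree n a b -> fps_agree n.+1 (step a) (step b).
Proof. by move=> eqab; apply/fps_agreeXM/fps_agree_comp. Qed.

Let iter_agree n a b : fps_agree n (iter n step a) (iter n step b).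
Proof. by elim: n => // n IHn; apply: step_agree. Qed.

Lemma fps_fixpoint_unique y z :
  y = fpsX * fps_comp F y -> z = fpsX * fps_comp F z -> y = z.
Proof.
move=> yE zE; suff eqyz n : fps_agree n y z.
  by apply/fpsP=> n; apply: (eqyz n.+1).
elim: n => // n IHn; rewrite yE zE; exact: step_agree.
Qed.

Lemma fps_fixpoint_exists : exists y, y = fpsX * fps_comp F y.
Proof.
(* The coefficient of x^n no longer changes after n + 1 steps from 0. *)
pose y := FPS (fun n => [x^ n] (iter n.+1 step 0)).
have y_iter n : fps_agree n y (iter n step 0).
  move=> i lt_in; rewrite -(subnKC lt_in) iterD; exact: iter_agree.
exists y; apply/fpsP=> n.
by symmetry; apply: (step_agree (y_iter n)).
Qed.

End FixedPoint.

(** * Composition as a ring morphism *)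

Section Composition.
Variables (R : comNzRingType) (u : fps R).
Hypothesis u0 : [x^ 0] u = 0.
Implicit Types F G : fps R.

(** Powers of [u] beyond the n-th do not reach the coefficient of x^n, so up to
    that degree a composite is a polynomial evaluated at [u], where
    multiplicativity is known.  The polynomial is free above degree n so that
    a product of two truncations qualifies in [fps_compM]. *)
Lemma fps_coef_comp_poly F (p : {poly R}) n :
  (forall i, (i <= n)%N -> p`_i = [x^ i] F) ->
  [x^ n] (fps_comp F u) = [x^ n] (map_poly (@fps_const R) p).[u].
Proof.
move=> pF; set m := maxn n.+1 (size p).
rewrite (@horner_coef_wide _ m) ?(leq_trans (size_poly _ _)) ?leq_maxr //.
rewrite fps_coef_sum [LHS]/=.
rewrite (big_ord_widen m (fun k => [x^ k] F * [x^ n] (u ^+ k))) ?leq_maxl //.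
rewrite big_mkcond; apply: eq_bigr => k _.
rewrite coef_map fps_coefCM ltnS; case: leqP => [/pF -> //|lt_nk].
by rewrite fps_coefX_eq0 ?mulr0.
Qed.

Lemma fps_compB F G : fps_comp (F - G) u = fps_comp F u - fps_comp G u.
Proof.
apply/fpsP=> n; rewrite fps_coefB /= -sumrB; apply: eq_bigr => k _.
by rewrite mulrBl.
Qed.

Lemma fps_compX : fps_comp fpsX u = u.
Proof.
apply/fpsP=> n; rewrite (@fps_coef_comp_poly _ 'X) ?map_polyX ?hornerX //.
by move=> i _; rewrite coefX.
Qed.

Lemma fps_comp1 : fps_comp 1 u = 1.
Proof.
apply/fpsP=> n; rewrite (@fps_coef_comp_poly _ 1) ?rmorph1 ?hornerC //.
by move=> [|i] _; rewrite coef1.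
Qed.

Lemma fps_compM F G : fps_comp (F * G) u = fps_comp F u * fps_comp G u.
Proof.
apply/fpsP=> n; pose t := @fps_trunc R n.+1.
have truncE H i : (i <= n)%N -> (t H)`_i = [x^ i] H.
  by move=> le_in; rewrite coef_fps_trunc.
rewrite (@fps_coef_comp_poly _ (t F * t G)) => [|i le_in]; last first.
  by rewrite -(@coef_fps_mul _ n.+1).
rewrite rmorphM hornerM.
apply: (@fps_agreeM _ n.+1) => // i le_in; symmetry;
  by apply: fps_coef_comp_poly => j le_ji; apply/truncE/(leq_trans le_ji).
Qed.

(** Packing composition with [u] as a morphism depends on the proof that [u] has
    no constant term, which canonical structure inference could not supply;
    hence an existence statement. *)
Lemma fps_comp_rmorphism :
  exists c : {rmorphism fps R -> fps R}, forall F, c F = fps_comp F u.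
Proof.
pose c F := fps_comp F u.
have cB : zmod_morphism c by exact: fps_compB.
have cM : monoid_morphism c by split; [exact: fps_comp1 | exact: fps_compM].
pose cA := GRing.isZmodMorphism.Build _ _ c cB.
pose cR := GRing.isMonoidMorphism.Build _ _ c cM.
by exists (HB.pack_for {rmorphism fps R -> fps R} c cA cR).
Qed.

End Composition.

(** * The Euler derivation x d/dx *)

Section Euler.
Variable R : comNzRingType.
Implicit Types a b : fps R.

(** Unlike d/dx, this operator does not shift degrees, which makes the Leibniz
    rule an identity between summands of equal index. *)
Definition fps_theta a : fps R := FPS (fun n => [x^ n] a *+ n).

Lemma fps_thetaB a b : fps_theta (a - b) = fps_theta a - fps_theta b.
Proof. by apply/fpsP=> n; rewrite fps_coefB /= mulrnBl. Qed.

Lemma fps_theta1 : fps_theta 1 = 0.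
Proof. by apply/fpsP=> -[|n] //=; rewrite mul0rn. Qed.

Lemma fps_thetaX : fps_theta fpsX = fpsX.
Proof. by apply/fpsP=> -[|[|n]] //=; rewrite mul0rn. Qed.

Lemma fps_thetaM a b : fps_theta (a * b) = fps_theta a * b + a * fps_theta b.
Proof.
apply/fpsP=> n; rewrite fps_coefD !fps_coefM /= -sumrMnl -big_split /=.
apply: eq_bigr => k _; rewrite mulrnAl mulrnAr -mulrnDr subnKC //.
by rewrite -ltnS.
Qed.

Lemma fps_thetaXn a m : fps_theta (a ^+ m.+1) = fps_theta a * a ^+ m *+ m.+1.
Proof.
elim: m => [|m IHm]; first by rewrite expr1 mulr1.
by rewrite exprS fps_thetaM IHm exprS; ring.
Qed.

End Euler.

(** * Lagrange inversion *)

Section Lagrange.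
Variables (R : numDomainType) (f g : fps R).
Hypothesis fg : f * g = 1.

(** With phi = x g, one has phi' = g + theta g, so this is the residue of
    phi^(-m-1) phi' dx: for m > 0 the form is the exact differential of
    - phi^(-m) / m and has none.  Concretely, m times the series is
    m f^m - theta (f^m), whose coefficient of x^m vanishes; cancelling the
    factor m is where characteristic 0 enters. *)
Lemma fps_residue m :
  [x^ m] ((g + fps_theta g) * f ^+ m.+1) = (m == 0%N)%:R.
Proof.
case: m => [|m]; rewrite ?eqxx.
  have <- : [x^ 0] (f * g) = 1 by rewrite fg.
  by rewrite !fps_coefM !big_ord_recl !big_ord0 /= mulr0n !addr0 mulrC.
have fDg : f * fps_theta g = - (g * fps_theta f).
  apply/eqP; rewrite -subr_eq0 opprK addrC [g * _]mulrC -fps_thetaM fg.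
  by rewrite fps_theta1.
have -> : (g + fps_theta g) * f ^+ m.+2 = f ^+ m.+1 - fps_theta f * f ^+ m.
  have -> : (g + fps_theta g) * f ^+ m.+2 =
      (f * g) * f ^+ m.+1 + (f * fps_theta g) * f ^+ m.+1 by rewrite !exprS; ring.
  rewrite fDg fg mul1r exprS; congr (_ + _).
  have -> : - (g * fps_theta f) * (f * f ^+ m) =
      - ((f * g) * (fps_theta f * f ^+ m)) by ring.
  by rewrite fg mul1r.
apply/eqP; rewrite -[_ == _](mulrn_eq0 _ m.+1) fps_coefB mulrnBl subr_eq0.
have coefMn (a : fps R) i k : [x^ i] (a *+ k) = [x^ i] a *+ k.
  by elim: k => // k IHk; rewrite !mulrS fps_coefD IHk.
by rewrite -(coefMn (fps_theta f * f ^+ m)) -fps_thetaXn.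
Qed.

(** By linearity it suffices to treat G = t^k; then phi^k f^(n+1) =
    x^k f^(n-k+1), and [fps_residue] picks out k = n. *)
Theorem fps_lagrange (G : fps R) n :
  [x^ n] (fps_comp G (fpsX * g) * (g + fps_theta g) * f ^+ n.+1) = [x^ n] G.
Proof.
set phi := fpsX * g.
have phi0 : [x^ 0] phi = 0 by rewrite fps_coefXM0.
pose S := \sum_(k < n.+1) fps_const ([x^ k] G) * phi ^+ k.
have agS : fps_agree n.+1 (fps_comp G phi) S.
  move=> i le_in.
  rewrite (@fps_coef_comp_poly _ _ phi0 _ (fps_trunc n.+1 G)) => [|j le_ji].
    rewrite (@horner_coef_wide _ n.+1) ?(leq_trans (size_poly _ _)) ?size_poly //.
    congr (fps_coef _ _); apply: eq_bigr => k _.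
    by rewrite coef_map coef_fps_trunc.
  by rewrite coef_fps_trunc // (leq_ltn_trans le_ji).
rewrite -mulrA (@fps_agreeM _ n.+1 _ S _ _ agS (fun _ _ => erefl)) //.
have term (k : nat) : (k <= n)%N ->
    [x^ n] (phi ^+ k * ((g + fps_theta g) * f ^+ n.+1)) = (n - k == 0)%N%:R.
  move=> le_kn; rewrite -fps_residue -[in RHS](@fps_coefXnM _ _ k) subnKC //.
  congr (fps_coef _ _).
  have -> : f ^+ n.+1 = f ^+ k * f ^+ (n - k).+1.
    by rewrite -exprD addnS subnKC.
  have -> : phi ^+ k * ((g + fps_theta g) * (f ^+ k * f ^+ (n - k).+1)) =
      fpsX ^+ k * (f * g) ^+ k * ((g + fps_theta g) * f ^+ (n - k).+1).
    by rewrite !exprMn; ring.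
  by rewrite fg expr1n mulr1.
have termC k : (k <= n)%N ->
    [x^ n] (fps_const ([x^ k] G) * phi ^+ k * ((g + fps_theta g) * f ^+ n.+1))
    = [x^ k] G * (n - k == 0)%N%:R.
  by move=> le_kn; rewrite -mulrA fps_coefCM term.
rewrite mulr_suml fps_coef_sum big_ord_recr termC // subnn mulr1.
rewrite big1 => [|k _]; first exact: add0r.
by rewrite termC ?(ltnW (ltn_ord k)) // subn_eq0 leqNgt (ltn_ord k) mulr0.
Qed.

End Lagrange.

(** * The quartic x (1 - x)^2 (1 + x) *)

Section Quartic.
Notation X := (fpsX : fps rat).

Lemma fps_unit1 (a : fps rat) : [x^ 0] a = 1 -> a \is a GRing.unit.
Proof. by move=> a0; change ([x^ 0] a \is a GRing.unit); rewrite a0. Qed.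

Lemma f_seriesK : f_series * ((1 - X) * (1 - X ^+ 2)) = 1.
Proof.
rewrite divrK //; apply: fps_unit1.
by rewrite fps_coef0M !fps_coefB expr2 fps_coef0M /= mulr0 !subr0 mulr1.
Qed.

(** The left-hand side is the derivative of x g, that is, of the quartic. *)
Lemma theta_denom (g := (1 - X) * (1 - X ^+ 2)) :
  g + fps_theta g = (1 - X) * (1 - X - 4 * X ^+ 2).
Proof.
rewrite /g expr2 !(fps_thetaM, fps_thetaB, fps_theta1, fps_thetaX).
by move: X => x; ring.
Qed.

Lemma f_series_compK (y : fps rat) : [x^ 0] y = 0 ->
  fps_comp f_series y * ((1 - y) * (1 - y ^+ 2)) = 1.
Proof.
move=> y0; have [c cE] := fps_comp_rmorphism y0.
have := congr1 c f_seriesK; move: f_series => F.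
by rewrite expr2 !(rmorphM c, rmorphB c, rmorph1 c) !cE fps_compX.
Qed.

Lemma quarticE (y : fps rat) :
  y * (1 - y) ^+ 2 * (1 + y) = y * ((1 - y) * (1 - y ^+ 2)).
Proof. by ring. Qed.

Lemma fixpoint_quartic (y : fps rat) : [x^ 0] y = 0 ->
  (y = X * fps_comp f_series y <-> y * (1 - y) ^+ 2 * (1 + y) = X).
Proof.
move=> y0; have := f_series_compK y0; set F := fps_comp _ _ => FK.
rewrite quarticE.
split=> [{1}->|<-]; first by rewrite -mulrA FK mulr1.
by rewrite -mulrA [_ * F]mulrC FK mulr1.
Qed.

(** The difference of the two quartics is y - z times a series [w] with constant
    term 1, because the quartic is x - x^2 - x^3 + x^4. *)
Lemma quartic_inj (y z : fps rat) : [x^ 0] y = 0 -> [x^ 0] z = 0 ->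
  y * (1 - y) ^+ 2 * (1 + y) = z * (1 - z) ^+ 2 * (1 + z) -> y = z.
Proof.
move=> y0 z0 /eqP; rewrite -subr_eq0.
set w := 1 - (y + z) - (y * y + y * z + z * z)
    + (y * (y * y) + y * (y * z) + y * (z * z) + z * (z * z)).
have -> : y * (1 - y) ^+ 2 * (1 + y) - z * (1 - z) ^+ 2 * (1 + z) = (y - z) * w.
  by rewrite /w; ring.
have Uw : w \is a GRing.unit.
  apply: fps_unit1; rewrite /w.
  rewrite !(fps_coefB, fps_coefD, fps_coef0M).
  by rewrite y0 z0 !(mulr0, addr0, subr0).
move/eqP/(congr1 (fun a => a / w)); rewrite mulrK // mul0r => /eqP.
by rewrite subr_eq0 => /eqP.
Qed.

End Quartic.

Theorem lemma1 :
  [/\ (exists! y : fps rat,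
         [x^ 0] y = 0 /\ y = fpsX * fps_comp f_series y),
      (forall y : fps rat, [x^ 0] y = 0 ->
         (y = fpsX * fps_comp f_series y <->
          y * (1 - y) ^+ 2 * (1 + y) = fpsX))
    & (forall y : fps rat, [x^ 0] y = 0 ->
         y = fpsX * fps_comp f_series y ->
         A_series = (1 - y ^+ 2) / (1 - y - 4 * y ^+ 2))].
Proof.
split; [|exact: fixpoint_quartic|].
  have [y yE] := fps_fixpoint_exists f_series.
  exists y; split=> [|z [_ zE]]; last exact: fps_fixpoint_unique yE zE.
  by split=> //; rewrite yE fps_coefXM0.
move=> y y0 yE; pose X := fpsX : fps rat.
pose g := (1 - X) * (1 - X ^+ 2); pose phi := X * g.
set B := (1 - y ^+ 2) / _.
have BK : B * (1 - y - 4 * y ^+ 2) = 1 - y ^+ 2.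
  rewrite divrK //; apply: fps_unit1.
  by rewrite !fps_coefB fps_coef0M expr2 fps_coef0M y0 !(mulr0, subr0).
have phi0 : [x^ 0] phi = 0 by rewrite fps_coefXM0.
have [c cE] := fps_comp_rmorphism phi0.
have cy : c y = X.
  apply: quartic_inj => //.
    by rewrite cE /= big_ord_recl big_ord0 y0 mul0r addr0.
  have := congr1 c (proj1 (fixpoint_quartic y0) yE).
  rewrite !(rmorphXn c, rmorphB c, rmorphM c, rmorphD c, rmorph1 c) [c fpsX]cE.
  by rewrite fps_compX // => ->; rewrite /phi quarticE.
have cB : c B * (1 - X - 4 * X ^+ 2) = 1 - X ^+ 2.
  have := congr1 c BK.
  by rewrite !(rmorphXn c, rmorphB c, rmorphM c, rmorphD c, rmorph1 c, rmorph_nat c) cy.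
apply/fpsP=> n; rewrite -(fps_lagrange f_seriesK B n).
rewrite -/X -/g -/phi -cE theta_denom.
have -> : c B * ((1 - X) * (1 - X - 4 * X ^+ 2)) = g.
  by rewrite mulrCA cB.
by rewrite exprS mulrA [g * _]mulrC f_seriesK mul1r.
Qed.
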